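(* Let $\Delta$ be a pure strongly shellable simplicial complex on the vertex set $[n]$ and let $\mathbb{K}$ be a field. Then the facet ideal $I(\Delta)=\langle \mathbf{x}^F \mid F\in\mathcal{F}(\Delta)\rangle\subseteq \mathbb{K}[x_1,\dots,x_n]$, where $\mathbf{x}^F=\prod_{i\in F}x_i$, has linear quotients.
   Context: A simplicial complex $\Delta$ is a finite family of subsets of a vertex set closed under taking subsets; $\mathcal{F}(\Delta)$ is its set of facets, $\dim(A)=|A|-1$; $\Delta$ is pure if all facets have the same dimension. A linear order $F_1,\dots,F_t$ of $\mathcal{F}(\Delta)$ is a strong shelling order if for every $1\le i<j\le t$ there exists $k$ with $1\le k<j$ such that $|F_j\setminus F_k|=1$, $F_j\setminus F_k\subseteq F_j\setminus F_i$, and $F_k\setminus F_j\subseteq F_i$; $\Delta$ is strongly shellable if such an order exists. A graded ideal $I$ of a polynomial ring has linear quotients if there is a system of homogeneous generators $f_1,\dots,f_m$ of $I$ such that the colon ideal $\langle f_1,\dots,f_{i-1}\rangle : f_i$ is generated by linear forms for all $i$. *)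

(* Defs.v *)
From mathcomp Require Import all_boot all_order all_algebra.
From mathcomp Require Import mpoly.

Set Implicit Arguments.
Unset Strict Implicit.
Unset Printing Implicit Defensive.

Import GRing.Theory.
Local Open Scope ring_scope.

Section Complexes.
Context {T : finType}.
Implicit Types (A B F : {set T}) (Delta : {set {set T}}) (s : seq {set T}).

(* Neither [Delta != set0] nor [[set v] \in Delta] for all v is required. *)
Definition simplicial_complex Delta : Prop :=
  forall A B, A \in Delta -> B \subset A -> B \in Delta.

Definition facets Delta : {set {set T}} :=
  [set F | maxset (fun A => A \in Delta) F].

(* Integer-valued, so that the empty face has dimension -1. *)
Definition face_dim A : int := #|A|%:Z - 1.

Definition pure Delta : Prop :=
  {in facets Delta &, forall F G, face_dim F = face_dim G}.

(* Positions are numbered from 0; the default [set0] of [nth] is never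
   reached. *)
Definition strong_shelling_order Delta s : Prop :=
  [/\ uniq s, s =i facets Delta
    & forall i j, (i < j < size s)%N ->
      exists2 k, (k < j)%N &
        let Fi := nth set0 s i in
        let Fj := nth set0 s j in
        let Fk := nth set0 s k in
        [/\ #|Fj :\: Fk| = 1%N, Fj :\: Fk \subset Fj :\: Fi
          & Fk :\: Fj \subset Fi]].

Definition strongly_shellable Delta : Prop :=
  exists s, strong_shelling_order Delta s.

End Complexes.

(* Ideals are Prop-valued predicates: MathComp's [idealr] structure only covers
   proper ideals with decidable membership. *)
Section Ideals.
Context {R : comNzRingType}.
Implicit Types (S I : R -> Prop) (f p : R).

Definition ideal_gen S : R -> Prop := fun p =>
  exists (m : nat) (a g : 'I_m -> R),
    (forall i, S (g i)) /\ p = \sum_(i < m) a i * g i.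

Definition colon I f : R -> Prop := fun p => I (p * f).

End Ideals.

Section LinearQuotients.
Context {n : nat} {K : fieldType}.
Implicit Types (I : {mpoly K[n]} -> Prop) (F : {set 'I_n}).

Definition generated_by_linear_forms I : Prop :=
  exists2 L : {mpoly K[n]} -> Prop,
    forall l, L l -> l \is 1.-homog & forall p, I p <-> ideal_gen L p.

Definition linear_quotients I : Prop :=
  exists fs : seq {mpoly K[n]},
    [/\ forall f, f \in fs -> exists d : nat, f \is d.-homog,
        forall p, I p <-> ideal_gen (fun f => f \in fs) p
      & forall i, (i < size fs)%N ->
          generated_by_linear_forms
            (colon (ideal_gen (fun f => f \in take i fs)) (nth 0 fs i))].

Definition set_monomial F : {mpoly K[n]} := \prod_(i in F) 'X_i.

End LinearQuotients.

Definition facet_ideal (n : nat) (K : fieldType) (Delta : {set {set 'I_n}}) :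
    {mpoly K[n]} -> Prop :=
  ideal_gen (fun p => exists2 F, F \in facets Delta & p = set_monomial F).

Arguments facet_ideal {n} K Delta p.

(* Main.v *)
(** The colon ideal of a monomial ideal by a monomial is decided on supports.
    Writing F_j for the j-th facet of a strong shelling order, a monomial x^m
    with x^m x^{F_j} in <x^{F_i} | i < j> is a multiple of some
    x^{F_i \ F_j}.  Strong shellability gives k < j with
    F_k \ F_j contained in F_i and |F_j \ F_k| = 1, and purity turns the
    latter into F_k \ F_j = {v}.  So x_v divides x^m, while x_v itself
    lies in the colon ideal because F_k is contained in F_j together with v.
    Hence such variables generate the colon ideal. *)
Require Import Defs.
From mathcomp Require Import all_boot all_order all_algebra.
From mathcomp Require Import mpoly.

Set Implicit Arguments.
Unset Strict Implicit.
Unset Printing Implicit Defensive.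

Import GRing.Theory.
Local Open Scope ring_scope.

Lemma ideal_gen_sub (R : comNzRingType) (S : R -> Prop) f :
  S f -> ideal_gen S f.
Proof.
move=> Sf; exists 1, (fun=> 1), (fun=> f); split=> //.
by rewrite big_ord1 mul1r.
Qed.

Lemma ideal_gen0 (R : comNzRingType) (S : R -> Prop) : ideal_gen S 0.
Proof.
exists 0, (fun=> 0), (fun=> 0); split; first by case.
by rewrite big_ord0.
Qed.

Lemma ideal_genD (R : comNzRingType) (S : R -> Prop) p q :
  ideal_gen S p -> ideal_gen S q -> ideal_gen S (p + q).
Proof.
move=> [m [a [g [Sg ->]]]] [m' [a' [g' [Sg' ->]]]].
pose glue (u : 'I_m -> R) u' (i : 'I_(m + m')) :=
  match split i with inl j => u j | inr j => u' j end.
exists (m + m'), (glue a a'), (glue g g'); split=> [i|].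
  by rewrite /glue; case: split.
rewrite big_split_ord; congr (_ + _); apply: eq_bigr => i _; rewrite /glue.
  by rewrite (unsplitK (inl _ i)).
by rewrite (unsplitK (inr _ i)).
Qed.

Lemma ideal_genM (R : comNzRingType) (S : R -> Prop) r p :
  ideal_gen S p -> ideal_gen S (r * p).
Proof.
move=> [m [a [g [Sg ->]]]]; exists m, (fun i => r * a i), g; split=> //.
by rewrite mulr_sumr; apply: eq_bigr => i _; rewrite mulrA.
Qed.

Lemma ideal_gen_min (R : comNzRingType) (S I : R -> Prop) :
    I 0 -> (forall p q, I p -> I q -> I (p + q)) ->
    (forall r p, I p -> I (r * p)) -> (forall f, S f -> I f) ->
  forall p, ideal_gen S p -> I p.
Proof.
move=> I0 ID IM IS p [m [a [g [Sg ->]]]].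
by elim/big_ind: _ => // i _; apply/IM/IS.
Qed.

Lemma eq_ideal_gen (R : comNzRingType) (S S' : R -> Prop) :
  (forall f, S f <-> S' f) -> forall p, ideal_gen S p <-> ideal_gen S' p.
Proof.
by move=> eqS p; split=> -[m [a [g [Sg ->]]]]; exists m, a, g; split=> // i;
  apply/eqS.
Qed.

Section MonomialIdeals.
Context {n : nat} {K : fieldType}.
Implicit Types (S : {mpoly K[n]} -> Prop) (P : 'X_{1..n} -> Prop).
Implicit Types (F G : {set 'I_n}) (p : {mpoly K[n]}).

(** Cancellation in a sum can only shrink its support, and every monomial of a summand [a i *
    'X_[u]] is a multiple of ['X_[u]]. *)
Lemma ideal_gen_mpolyX_supp S P p m :
    (forall f, S f -> exists2 u, P u & f = 'X_[u]) ->
    ideal_gen S p -> m \in msupp p ->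
  exists2 u, P u & (u <= m)%MM.
Proof.
move=> SX [l [a [g [Sg ->]]]] /msupp_sum_le /flatten_mapP[i _].
move=> /msuppM_le /allpairsP[[m1 m2] /= [_ + ->]].
by have [u Pu ->] := SX _ (Sg i); rewrite msuppX inE => /eqP ->;
  exists u => //; apply: lem_addl.
Qed.

(** A polynomial is a linear combination of the monomials in its support, so membership can be
    tested one monomial at a time. *)
Lemma ideal_gen_msupp S p :
    (forall m, m \in msupp p -> ideal_gen S 'X_[m]) -> ideal_gen S p.
Proof.
move=> IX; rewrite [p]mpolyE big_seq.
elim/big_ind: _ => [|q r|m /IX Im]; first exact: ideal_gen0.
  exact: ideal_genD.
by rewrite -mul_mpolyC; apply: ideal_genM.
Qed.

Lemma mpolyX_le (m u : 'X_{1..n}) : (u <= m)%MM -> 'X_[K, m] = 'X_[m - u] * 'X_[u].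
Proof. by move=> le_um; rewrite -mpolyXD submK. Qed.

Lemma set_monomialE F : set_monomial F = 'X_[K, mesym1 F].
Proof.
rewrite /set_monomial mpolyXE_id big_mkcond; apply: eq_bigr => i _.
by rewrite mnmE; case: (i \in F).
Qed.

(** The exponents of [mesym1 F] are 0 or 1, and [mesym1 G] already supplies the 1 at every index of
    [G]; only the indices in [F :\: G] constrain [m]. *)
Lemma mesym1_leD F G (m : 'X_{1..n}) :
  (mesym1 F <= m + mesym1 G)%MM = [forall i in F :\: G, U_(i) <= m]%MM.
Proof.
apply/mnm_lepP/forall_inP => le_F i.
  rewrite lep1mP inE => /andP[/negPf nGi Fi].
  by have := le_F i; rewrite mnmDE !mnmE Fi nGi addn0 lt0n.
rewrite mnmDE !mnmE; case Fi: (i \in F) => //.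
case Gi: (i \in G); first by rewrite addn1.
by rewrite addn0 lt0n -lep1mP; apply: le_F; rewrite inE Fi Gi.
Qed.

(** Isolates the combinatorial condition for a single colon ideal, with [s] in the role of the
    facets preceding [G]. *)
Lemma colon_set_monomials (s : seq {set 'I_n}) G :
    (forall F, F \in s -> exists2 H, H \in s &
       exists2 v, H :\: G = [set v] & v \in F) ->
  generated_by_linear_forms
    (colon (ideal_gen (fun f : {mpoly K[n]} => f \in map set_monomial s))
       (set_monomial G)).
Proof.
move=> sG.
exists (fun l => exists2 H, H \in s &
                 exists2 v, H :\: G = [set v] & l = 'X_v).
  by move=> _ [H _ [v _ ->]]; rewrite dhomogX /= mdeg1.
move=> p; split=> [Ip|].
  apply: ideal_gen_msupp => m pm.
  (* Multiplying by a monomial shifts the support injectively, so no term of [p] is lost. *)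
  have pGm : (m + mesym1 G)%MM \in msupp (p * set_monomial G).
    by rewrite set_monomialE mcoeff_msupp addmC mcoeffMX -mcoeff_msupp.
  have [f|_ [F sF ->]] := ideal_gen_mpolyX_supp
    (P := fun u => exists2 F, F \in s & u = mesym1 F) _ Ip pGm.
    by case/mapP=> F sF ->; exists (mesym1 F); [exists F|exact: set_monomialE].
  rewrite mesym1_leD => /forall_inP le_m.
  have [H sH [v HGv Fv]] := sG F sF.
  have nGv : v \notin G by have := set11 v; rewrite -HGv inE => /andP[].
  rewrite (mpolyX_le (le_m v _)); last by rewrite inE nGv.
  by apply/ideal_genM/ideal_gen_sub; exists H => //; exists v.
(* The colon is closed under the ideal operations, so only the variables ['X_v] remain to be
   checked. *)
move: p; apply: ideal_gen_min => [|p q|r p|_ [H sH [v HGv ->]]]; rewrite /colon.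
- by rewrite mul0r; apply: ideal_gen0.
- by rewrite mulrDl; apply: ideal_genD.
- by rewrite -mulrA; apply: ideal_genM.
(* As [H] lies in [G] together with [v], the monomial of [H] divides ['X_v] times that of [G]. *)
rewrite set_monomialE -mpolyXD (@mpolyX_le _ (mesym1 H)); last first.
  by rewrite mesym1_leD HGv; apply/forall_inP => i /set1P ->; apply: lepm_refl.
rewrite -set_monomialE; apply/ideal_genM/ideal_gen_sub; exact: map_f.
Qed.

End MonomialIdeals.

Lemma pure_setD1 (T : finType) (Delta : {set {set T}}) F G :
    pure Delta -> F \in facets Delta -> G \in facets Delta ->
    #|F :\: G| = 1%N ->
  exists v, G :\: F = [set v].
Proof.
move=> pureD DF DG FG1; apply/cards1P.
(* Cancelling the -1 of the integer dimensions leaves equal cardinalities; subtracting the common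
   part [F :&: G] makes both differences equally large. *)
have /addIr [eqFG] := pureD F G DF DG.
have := cardsID G F; have := cardsID F G.
by rewrite setIC FG1 eqFG => <- /addnI <-.
Qed.

Theorem theorem4p11 (n : nat) (K : fieldType) (Delta : {set {set 'I_n}})
    (Delta_complex : simplicial_complex Delta)
    (Delta_pure : pure Delta)
    (Delta_shellable : strongly_shellable Delta) :
  linear_quotients (facet_ideal K Delta).
Proof.
have [s [_ sE shell]] := Delta_shellable.
exists (map set_monomial s); split=> [_ /mapP[F _ ->]|p|j].
- by exists (mdeg (mesym1 F)); rewrite set_monomialE dhomogX /=.
- apply: eq_ideal_gen => f; split=> [[F DF ->]|/mapP[F sF ->]].
    by apply: map_f; rewrite sE.
  by exists F; rewrite // -sE.
rewrite size_map => lt_js; rewrite -map_take (nth_map set0) //.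
apply: colon_set_monomials => F /(nthP set0)[i].
rewrite size_takel ?(ltnW lt_js) // => lt_ij; rewrite nth_take // => <-.
have [|k lt_kj [jk1 _ kj_i]] := shell i j; first by rewrite lt_ij.
have Ds l : (l < size s)%N -> nth set0 s l \in facets Delta.
  by move=> lt_ls; rewrite -sE mem_nth.
have lt_ks := ltn_trans lt_kj lt_js.
have [v kjv] := pure_setD1 Delta_pure (Ds j lt_js) (Ds k lt_ks) jk1.
(* Since [k < j], this facet survives in [take j s]. *)
exists (nth set0 s k).
  by rewrite -(nth_take _ lt_kj) mem_nth // size_takel // ltnW.
by exists v => //; apply: (subsetP kj_i); rewrite kjv set11.
Qed.
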